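(* A profinite group $G$ is small if and only if it satisfies the following property: whenever $H$ is a profinite group such that $\operatorname{fin}(G)=\operatorname{fin}(H)$, then $G\cong H$.
   Context: All homomorphisms and isomorphisms between profinite groups are continuous. A profinite group $G$ is small if for every $n\in\mathbb{N}$ it has only finitely many open normal subgroups of index $n$. For a profinite group $G$, $\operatorname{fin}(G)$ denotes the set of isomorphism classes of the finite groups $G/U$, as $U$ varies over the open normal subgroups of $G$. *)

(* Defs.v *)
(* MathComp / MathComp-Analysis; [groupType] is the class of arbitrary (possibly
   infinite) multiplicative groups of monoid.v. *)
From HB Require Import structures.
From mathcomp Require Import all_boot.
From mathcomp Require Import boolp classical_sets functions cardinality topology.

Set Implicit Arguments.
Unset Strict Implicit.
Unset Printing Implicit Defensive.

Local Open Scope classical_set_scope.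
Local Open Scope group_scope.

HB.mixin Record Group_isTopologicalGroup (G : Type) of Group G & Topological G := {
  mulg_continuous : continuous (fun xy : G * G => xy.1 * xy.2);
  invg_continuous : continuous (fun x : G => x^-1)
}.

#[short(type="topGroupType")]
HB.structure Definition TopologicalGroup :=
  {G of Group G & Topological G & Group_isTopologicalGroup G}.

HB.mixin Record TopologicalGroup_isProfinite (G : Type) of TopologicalGroup G := {
  profinite_compact : compact [set: G];
  profinite_hausdorff : hausdorff_space G;
  profinite_totally_disconnected : totally_disconnected [set: G]
}.

#[short(type="profiniteGroupType")]
HB.structure Definition ProfiniteGroup :=
  {G of TopologicalGroup G & TopologicalGroup_isProfinite G}.

Section Cosets.
Variable G : groupType.
Implicit Types (N A B : set G) (x y : G).

Definition normal_subgroup N : Prop :=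
  [/\ N 1, forall x y, N x -> N y -> N (x / y) & forall x y, N x -> N (x ^ y)].

Definition gcoset N x : set G := [set x * y | y in N].

Definition gcosets N : set (set G) := range (gcoset N).

Definition has_index N (n : nat) : Prop := (gcosets N #= `I_n)%card.

Definition pointwise_mul A B : set G := [set z.1 * z.2 | z in A `*` B].
Definition pointwise_inv A : set G := [set x^-1 | x in A].

Lemma normal_subgroupV N x : normal_subgroup N -> N x -> N x^-1.
Proof. by move=> [N1 NF _] Nx; rewrite -[x^-1]mul1g; apply: NF. Qed.

Lemma normal_subgroupM N x y : normal_subgroup N -> N x -> N y -> N (x * y).
Proof.
move=> nN Nx Ny; have [_ NF _] := nN.
by rewrite -[y]invgK; apply: NF => //; apply: normal_subgroupV.
Qed.

Lemma gcoset1 N : gcoset N 1 = N.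
Proof.
by apply/seteqP; split=> [_ [y Ny <-]|y Ny]; [rewrite mul1g|exists y; rewrite ?mul1g].
Qed.

Lemma gcosetP N x z : gcoset N x z <-> N (x^-1 * z).
Proof.
split=> [[y Ny <-]|Nz]; first by rewrite mulKg.
by exists (x^-1 * z) => //; rewrite mulVKg.
Qed.

Lemma gcosetM N x y : normal_subgroup N ->
  pointwise_mul (gcoset N x) (gcoset N y) = gcoset N (x * y).
Proof.
move=> nN; have [N1 NF NJ] := nN; apply/seteqP; split.
  move=> _ [[_ _] /= [[a Na <-] [b Nb <-]] <-] /=.
  exists (a ^ y * b); first by apply: normal_subgroupM => //; apply: NJ.
  by rewrite conjgE -!mulgA mulVKg.
move=> _ [a Na <-]; exists (x, y * a); last by rewrite /= mulgA.
by split=> /=; [exists 1; rewrite ?mulg1|exists a].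
Qed.

Lemma gcosetV N x : normal_subgroup N ->
  pointwise_inv (gcoset N x) = gcoset N x^-1.
Proof.
move=> nN; have [N1 NF NJ] := nN; apply/seteqP; split.
  move=> _ [_ [a Na <-] <-]; exists (a^-1 ^ x^-1).
    by apply: NJ; apply: normal_subgroupV.
  by rewrite conjgE invgK mulKg invgM.
move=> _ [a Na <-]; exists (a^-1 * x); last by rewrite invgM invgK.
exists (a^-1 ^ x); first by apply: NJ; apply: normal_subgroupV.
by rewrite conjgE mulVKg.
Qed.

End Cosets.

Record normalSubgroup (G : groupType) := NormalSubgroup {
  normal_set :> set G;
  normal_setP : normal_subgroup normal_set
}.

(* Elements are the cosets themselves, multiplied and inverted as subsets of [G]. *)
Definition quotient_group (G : groupType) (N : normalSubgroup G) : Type :=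
  set_type (gcosets N).

HB.instance Definition _ (G : groupType) (N : normalSubgroup G) :=
  Choice.on (quotient_group N).

Section QuotientGroup.
Variables (G : groupType) (N : normalSubgroup G).
Implicit Types A B : quotient_group N.

Lemma quot_mul_subproof A B :
  pointwise_mul (val A) (val B) \in gcosets N.
Proof.
have [[x _ xA] [y _ yB]] := (set_valP A, set_valP B).
rewrite inE; exists (x * y) => //.
by rewrite -gcosetM; [rewrite -[val A]xA -[val B]yB|exact: normal_setP].
Qed.

Lemma quot_inv_subproof A : pointwise_inv (val A) \in gcosets N.
Proof.
have [x _ xA] := set_valP A; rewrite inE; exists x^-1 => //.
by rewrite -gcosetV; [rewrite -[val A]xA|exact: normal_setP].
Qed.

Lemma quot_one_subproof : (N : set G) \in gcosets N.
Proof. by rewrite inE; exists 1 => //; rewrite gcoset1. Qed.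

Definition quot_mul A B : quotient_group N := SigSub (quot_mul_subproof A B).
Definition quot_inv A : quotient_group N := SigSub (quot_inv_subproof A).
Definition quot_one : quotient_group N := SigSub quot_one_subproof.

Lemma quot_repr A : exists x, val A = gcoset N x.
Proof. by have [x _ <-] := set_valP A; exists x. Qed.

Lemma quot_mulA : associative quot_mul.
Proof.
move=> A B C; apply: val_inj => /=.
have [[x ->] [[y ->] [z ->]]] := (quot_repr A, (quot_repr B, quot_repr C)).
by rewrite !gcosetM ?mulgA //; exact: normal_setP.
Qed.

Lemma quot_mul1 : left_id quot_one quot_mul.
Proof.
move=> A; apply: val_inj => /=; have [x ->] := quot_repr A.
by rewrite -{1}(gcoset1 N) gcosetM ?mul1g //; exact: normal_setP.
Qed.

Lemma quot_mulr1 : right_id quot_one quot_mul.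
Proof.
move=> A; apply: val_inj => /=; have [x ->] := quot_repr A.
by rewrite -{2}(gcoset1 N) gcosetM ?mulg1 //; exact: normal_setP.
Qed.

Lemma quot_mulV : left_inverse quot_one quot_inv quot_mul.
Proof.
move=> A; apply: val_inj => /=; have [x ->] := quot_repr A.
by rewrite gcosetV ?gcosetM ?mulVg ?gcoset1 //; exact: normal_setP.
Qed.

Lemma quot_mulrV : right_inverse quot_one quot_inv quot_mul.
Proof.
move=> A; apply: val_inj => /=; have [x ->] := quot_repr A.
by rewrite gcosetV ?gcosetM ?mulgV ?gcoset1 //; exact: normal_setP.
Qed.

HB.instance Definition _ := isGroup.Build (quotient_group N)
  quot_mulA quot_mul1 quot_mulr1 quot_mulV quot_mulrV.

End QuotientGroup.

Definition group_isomorphic (G H : groupType) : Prop :=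
  exists2 f : G -> H, {morph f : x y / x * y} & bijective f.

Definition iso_class (Q : groupType) : groupType -> Prop :=
  fun F => group_isomorphic Q F.

(* An element [C] of [fin G] is an isomorphism class.  The quotients are
   automatically finite: an open subgroup of a compact group has finite index.
   Plain predicates replace [set _] because the carrier of a quotient group lives
   in [set G], which makes [set groupType] universe inconsistent. *)
Definition fin (G : profiniteGroupType) : (groupType -> Prop) -> Prop :=
  fun C => exists2 U : normalSubgroup G,
    open (U : set G) & C = iso_class (quotient_group U).

Definition small (G : profiniteGroupType) : Prop :=
  forall n : nat, finite_set
    [set U : set G | [/\ normal_subgroup U, open U & has_index U n]].

Definition topgroup_isomorphic (G H : topGroupType) : Prop :=
  exists (f : G -> H) (g : H -> G),
    [/\ {morph f : x y / x * y}, continuous f, continuous g,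
        cancel f g & cancel g f].

(* Main.v *)
(* If [G] is small and [core G n] denotes the intersection of its open normal
   subgroups of index at most [n], then [fin G = fin H] forces
   [G / core G n ~ H / core H n] for every [n].  Lifting these isomorphisms to
   arbitrary maps [s n : G -> H] and taking the limit of [s n x] along an
   ultrafilter on [nat] gives an isomorphism [G ~ H].

   If [G] is not small, it has an infinite sequence [e] of open normal subgroups of
   bounded index.  For an ultrafilter on [I], let [H] be the completion of the power
   [I -> G] along the subgroups [{g | g i \in U i for almost all i}], where [U] ranges
   over the families of open normal subgroups of bounded index.  The quotient by
   such a subgroup is an ultraproduct of finite groups of bounded order, hence
   isomorphic to one of the [G / U i]; therefore [fin H = fin G].  For [I] the
   finite sequences over a large type and a regular ultrafilter on [I], the families
   extracted from [e] give too many open subgroups of [H] for [H] to be in bijection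
   with [G]. *)
Require Import Defs.
From HB Require Import structures.
From mathcomp Require Import all_boot.
From mathcomp Require Import boolp classical_sets functions cardinality topology.

Set Implicit Arguments.
Unset Strict Implicit.
Unset Printing Implicit Defensive.

Local Open Scope classical_set_scope.
Local Open Scope group_scope.

(** * Isomorphisms of quotients *)

Section CosetMap.
Variables (G : groupType) (N : normalSubgroup G).
Implicit Types x y : G.

Lemma coset_subproof x : gcoset N x \in gcosets N.
Proof. by rewrite inE; exists x. Qed.

Definition coset x : quotient_group N := SigSub (coset_subproof x).

Lemma coset_surj (A : quotient_group N) : exists x, coset x = A.
Proof. by have [x Ax] := quot_repr A; exists x; apply: val_inj. Qed.

Lemma cosetM x y : coset (x * y) = coset x * coset y.
Proof. by apply: val_inj; rewrite /= gcosetM //; exact: normal_setP. Qed.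

Lemma coset1P x : coset x = 1 <-> (N : set G) x.
Proof.
split=> [/(congr1 val) /= Nx|Nx].
  have [N1 _ _] := normal_setP N.
  have : gcoset N x x by exists 1; rewrite ?mulg1.
  by rewrite Nx.
apply: val_inj; apply/seteqP; split=> /= y; rewrite gcosetP.
  by move=> Ny; rewrite -[y](mulVKg x); apply: normal_subgroupM; first exact: normal_setP.
move=> Ny; apply: normal_subgroupM Ny; first exact: normal_setP.
by apply: normal_subgroupV Nx; exact: normal_setP.
Qed.

Lemma coset1 : coset 1 = 1.
Proof. by apply/coset1P; have [] := normal_setP N. Qed.

Lemma cosetV x : coset x^-1 = (coset x)^-1.
Proof.
by apply: (mulgI (coset x)); rewrite -cosetM !mulgV coset1.
Qed.

Lemma cosetE x y : coset x = coset y <-> (N : set G) (x^-1 * y).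
Proof.
rewrite -coset1P cosetM cosetV; split=> [->|xy]; first by rewrite mulVg.
by apply: (mulgI (coset x)^-1); rewrite xy mulVg.
Qed.

End CosetMap.

Lemma coset_sub (G : groupType) (M N : normalSubgroup G) x y :
  (M : set G) `<=` N -> coset M x = coset M y -> coset N x = coset N y.
Proof. by move=> MN /cosetE /MN Nxy; apply/cosetE. Qed.

Section QuotIso.
Variables (A B : groupType).
Implicit Types (M : normalSubgroup A) (N : normalSubgroup B).

(** Here [f] is a bare map on elements; only the map it induces from [A / M] to [B / N] is an
    isomorphism. The same [f] can then serve several pairs of subgroups at once and enter a
    pointwise limit. *)
Record quot_iso (f : A -> B) M N : Prop := QuotIso {
  quot_iso_coset : forall x y, coset N (f x) = coset N (f y) <-> coset M x = coset M y;
  quot_isoM : forall x y, coset N (f (x * y)) = coset N (f x) * coset N (f y);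
  quot_iso_surj : forall z, exists x, coset N (f x) = coset N z }.

Lemma quot_iso1 f M N : quot_iso f M N -> coset N (f 1) = 1.
Proof.
case=> _ fM _; have := fM 1 1; rewrite mulg1 => f1.
by apply: (mulgI (coset N (f 1))); rewrite mulg1 -f1.
Qed.

Lemma quot_isoV f M N x : quot_iso f M N -> coset N (f x^-1) = (coset N (f x))^-1.
Proof.
move=> fi; apply: (mulgI (coset N (f x))).
by rewrite mulgV -(quot_isoM fi) mulgV (quot_iso1 fi).
Qed.

Lemma quot_iso_mem f M N x : quot_iso f M N -> (N : set B) (f x) <-> (M : set A) x.
Proof.
by move=> fi; rewrite -coset1P -coset1P -(quot_iso1 fi) -(coset1 M); apply: quot_iso_coset.
Qed.

(** Correspondence theorem: modulo the coarser [N'] the map [f] still respects products, so the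
    preimage of [N'] is normal and [f] itself induces the new isomorphism. *)
Lemma quot_iso_preim f M N (N' : normalSubgroup B) :
  quot_iso f M N -> (N : set B) `<=` N' ->
  exists M' : normalSubgroup A, [/\ (M' : set A) = f @^-1` N',
    (M : set A) `<=` M' & quot_iso f M' N'].
Proof.
move=> fi NN'.
have fM x y : coset N' (f (x * y)) = coset N' (f x) * coset N' (f y).
  by rewrite -cosetM; apply: coset_sub NN' _; rewrite cosetM (quot_isoM fi).
have fV x : coset N' (f x^-1) = (coset N' (f x))^-1.
  by rewrite -cosetV; apply: coset_sub NN' _; rewrite cosetV (quot_isoV _ fi).
have f1 : coset N' (f 1) = 1.
  by rewrite -(coset1 N'); apply: coset_sub NN' _; rewrite coset1 (quot_iso1 fi).
have nM' : normal_subgroup (f @^-1` N').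
  split=> [|x y|x y] /=; first by apply/coset1P.
    by move=> /coset1P fx /coset1P fy; apply/coset1P; rewrite fM fV fx fy mulgV.
  by move=> /coset1P fx; apply/coset1P; rewrite conjgE !fM fV fx mul1g mulVg.
exists (NormalSubgroup nM'); split=> //.
  by move=> x Mx; apply: NN'; apply/(quot_iso_mem _ fi).
split=> //= [x y|z].
  rewrite [X in _ <-> X]cosetE /= -coset1P fM fV; split=> [->|fxy]; first by rewrite mulVg.
  by apply: (mulgI (coset N' (f x))^-1); rewrite fxy mulVg.
by have [x fx] := quot_iso_surj fi z; exists x; apply: coset_sub NN' _.
Qed.

End QuotIso.

Lemma quot_iso_sym (A B : groupType) (f : A -> B) M N :
  quot_iso f M N -> exists g : B -> A, quot_iso g N M /\
    (forall z, coset N (f (g z)) = coset N z) /\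
    (forall x, coset M (g (f x)) = coset M x).
Proof.
move=> fi; have [g fg] := choice (quot_iso_surj fi); have [fE fM _] := fi.
exists g; split; last first.
  by split=> // x; apply/fE.
split=> [x y|x y|x]; first by rewrite -fE !fg.
  by rewrite -cosetM; apply/fE; rewrite fM !fg cosetM.
by exists (f x); apply/fE.
Qed.

Lemma quot_iso_comp (A B C : groupType) (f : A -> B) (g : B -> C) M N K :
  quot_iso f M N -> quot_iso g N K -> quot_iso (g \o f) M K.
Proof.
move=> fi gi; split=> /= [x y|x y|z].
- by rewrite (quot_iso_coset gi) (quot_iso_coset fi).
- rewrite -(quot_isoM gi); apply/(quot_iso_coset gi).
  by rewrite (quot_isoM fi) cosetM.
- have [y gy] := quot_iso_surj gi z; have [x fx] := quot_iso_surj fi y.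
  by exists x; rewrite -gy; apply/(quot_iso_coset gi).
Qed.

(** Chosen coset representatives turn an isomorphism of quotients into a map on elements, and
    back. *)
Lemma quot_isoP (A B : groupType) (M : normalSubgroup A) (N : normalSubgroup B) :
  (exists f, quot_iso f M N) <->
  group_isomorphic (quotient_group M) (quotient_group N).
Proof.
split=> [[f fi]|[F FM [F' FK F'K]]].
  have [g [gi [fg gf]]] := quot_iso_sym fi.
  have [r rK] := choice (@coset_surj _ M); have [s sK] := choice (@coset_surj _ N).
  exists (fun a => coset N (f (r a))).
    move=> a b /=; rewrite -(quot_isoM fi); apply/(quot_iso_coset fi).
    by rewrite cosetM !rK.
  exists (fun b => coset M (g (s b))) => a.
    rewrite -[RHS]rK -[RHS]gf; apply/(quot_iso_coset gi); exact: sK.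
  by rewrite -[RHS]sK -[RHS]fg; apply/(quot_iso_coset fi); exact: rK.
have [s sK] := choice (@coset_surj _ N).
exists (fun x => s (F (coset M x))); split=> [x y|x y|z]; rewrite ?sK.
- by split=> [/(can_inj FK)|->].
- by rewrite cosetM FM.
- have [x xz] := coset_surj (F' (coset N z)).
  by exists x; rewrite sK xz F'K.
Qed.

Lemma group_isomorphic_refl (A : groupType) : group_isomorphic A A.
Proof. by exists id => //; exists id. Qed.

Lemma group_isomorphic_sym (A B : groupType) :
  group_isomorphic A B -> group_isomorphic B A.
Proof.
case=> f fM [g fK gK]; exists g; last by exists f.
by move=> x y; apply: (can_inj fK); rewrite fM !gK.
Qed.

Lemma group_isomorphic_trans (A B C : groupType) :
  group_isomorphic A B -> group_isomorphic B C -> group_isomorphic A C.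
Proof.
move=> [f fM fb] [g gM gb]; exists (g \o f); last exact: bij_comp.
by move=> x y /=; rewrite fM gM.
Qed.

Lemma iso_classP (A B : groupType) :
  iso_class A = iso_class B <-> group_isomorphic A B.
Proof.
split=> [AB|AB].
  have : iso_class B B by exact: group_isomorphic_refl.
  by rewrite -AB.
apply: funext => C; apply: propext; split; apply: group_isomorphic_trans => //.
exact: group_isomorphic_sym.
Qed.

(** * Open subgroups of profinite groups *)

Section ZeroDimensional.
Variable T : topologicalType.
Hypotheses (hT : hausdorff_space T) (cT : compact [set: T]).
Implicit Types x : T.

Definition quasicomponent x : set T := [set y | forall U, clopen U -> U x -> U y].

(** Each point outside [O] is missed by some clopen set containing [x]. Such sets are stable under
    finite intersections, so compactness of the complement of [O] yields one that misses it
    entirely. *)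
Lemma clopen_sub_open x (O : set T) : open O -> quasicomponent x `<=` O ->
  exists U : set T, [/\ clopen U, U x & U `<=` O].
Proof.
move=> oO QO; pose F := filter_from [set D : set T | D x /\ clopen D] id.
have FF : Filter F.
  apply: filter_from_filter; first by exists setT; split => //; exact: clopenT.
  by move=> A B [? ?] [? ?]; exists (A `&` B) => //; split=> //; exact: clopenI.
have PF : ProperFilter F by apply: filter_from_proper; move=> ? [? _]; exists x.
have /(iffLR (compact_near_coveringP _)) : compact (~` O).
  by apply: (subclosed_compact _ cT) => //; exact: open_closedC.
move=> /(_ _ _ setC (powerset_filter_from_filter PF))[].
  move=> y nOy.
  have /existsNP [C /not_implyP [[oC cC] /not_implyP [Cx nCy]]] :
    ~ quasicomponent x y by move=> /QO.
  exists (~` C, [set U | U `<=` C]); first split.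
  - by apply: open_nbhs_nbhs; split => //; exact: closed_openC.
  - apply/near_powerset_filter_fromP; first by move=> ? ?; exact: subset_trans.
    by exists C => //; exists C.
  - by case=> i j [? /subsetC]; apply.
move=> D [DF _ [C DC]] /(_ _ DC) /subsetC2 CO.
by have [V [Vx cV] VC] := DF _ DC; exists V; split=> // y /VC /CO.
Qed.

(** If [B] is relatively clopen and nonempty, normality gives an open [W] containing [B] whose
    closure avoids the rest of the quasicomponent. Cutting a suitable clopen neighbourhood of [x]
    along [W] leaves a clopen set, which must contain the whole quasicomponent or miss it. *)
Lemma quasicomponent_connected x : connected (quasicomponent x).
Proof.
set Q := quasicomponent x.
have Qx : Q x by move=> U.
have cQ : closed Q.
  have -> : Q = \bigcap_(U in [set U | clopen U /\ U x]) U.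
    by apply/seteqP; split=> y Qy; [move=> U [cU Ux]|move=> U cU Ux]; apply: Qy.
  by apply: closed_bigI => U [[]].
move=> B [b Bb] [C oC BC] [D cD BD].
have cB : closed B by rewrite BD; exact: closedI.
have snC : set_nbhs B (~` (Q `\` B)).
  apply/set_nbhsP; exists (~` (Q `&` ~` C)); split.
  - by apply: closed_openC; apply: closedI cQ _; exact: open_closedC.
  - by move=> y; rewrite BC => -[Qy Cy] [].
  - by move=> y nQC [Qy nBy]; apply: nQC; split=> // Cy; apply: nBy; rewrite BC.
have [V /set_nbhsP [W [oW BW WV]] VC] := compact_normal hT cT cB snC.
have clW y : Q y -> closure W y -> B y.
  by move=> Qy Wy; apply: contrapT => nBy; apply: (VC y) => //; apply: closureS WV _ Wy.
have [||U [[oU cU] Ux UO]] := @clopen_sub_open x (W `|` ~` closure W).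
- by apply: openU => //; apply/closed_openC/closed_closure.
- move=> y Qy; have [/(clW _ Qy) /BW|] := pselect (closure W y); first by left.
  by right.
have UW : U `&` W = U `&` closure W.
  apply/seteqP; split=> y [Uy]; first by split=> //; exact: subset_closure.
  by have [|? ?] := UO _ Uy.
have cUW : clopen (U `&` W).
  split; first exact: openI.
  by rewrite UW; apply: closedI => //; exact: closed_closure.
have [UWx|nUWx] := pselect ((U `&` W) x).
  apply/seteqP; split=> y; first by rewrite BC => -[].
  by move=> Qy; apply: clW => //; have := Qy _ cUW UWx; rewrite UW => -[].
have : Q b by move: Bb; rewrite BC => -[].
move=> Qb; have Ub : U b by apply: Qb.
by have := Qb _ (clopenC (U `&` W) cUW) nUWx; case; split=> //; exact: BW.
Qed.

Lemma totally_disconnected_zero_dimensional :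
  totally_disconnected [set: T] -> zero_dimensional T.
Proof.
move=> tdT x y xy; apply: contrapT => noU.
have Qy : quasicomponent x y.
  by move=> U cU Ux; apply: contrapT => nUy; apply: noU; exists U.
have : connected_component [set: T] x y.
  apply: connected_component_max Qy => //; last exact: quasicomponent_connected.
by rewrite tdT // => /= yx; rewrite yx eqxx in xy.
Qed.

End ZeroDimensional.

(** * Open normal subgroups as a base at the identity *)

Section OpenSubgroups.
Variable G : profiniteGroupType.
Implicit Types (U : normalSubgroup G) (x y : G).

Lemma mulg_cvg T (F : set_system T) (FF : Filter F) (f g : T -> G) x y :
  f @ F --> x -> g @ F --> y -> (f t * g t) @[t --> F] --> x * y.
Proof.
move=> fx gy; apply: (@continuous2_cvg _ G G G F FF f g (fun x y => x * y)) fx gy.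
exact: (mulg_continuous (x, y)).
Qed.

Lemma open_subgroup_near (U : set G) : normal_subgroup U ->
  (\forall x \near (1 : G), U x) -> open U.
Proof.
move=> nU U1; rewrite openE => x Ux.
have : (x^-1 * y) @[y --> x] --> x^-1 * x.
  by apply: mulg_cvg => //; exact: cvg_cst.
rewrite mulVg => /(_ _ U1); rewrite /interior !nbhs_simpl /=.
apply: filterS => y Uy; rewrite -[y](mulVKg x).
exact: normal_subgroupM.
Qed.

Lemma open_subgroup_near1 U x : open (U : set G) -> \forall y \near x, coset U y = coset U x.
Proof.
move=> oU; have U1 : (U : set G) (x^-1 * x).
  by rewrite mulVg; have [] := normal_setP U.
have : (x^-1 * y) @[y --> x] --> x^-1 * x.
  by apply: mulg_cvg => //; exact: cvg_cst.
move=> /(_ _ (open_nbhs_nbhs (conj oU U1))); rewrite !nbhs_simpl /=.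
by apply: filterS => y Uy; apply/esym/cosetE.
Qed.

Lemma open_subgroup_sub U (V : set G) : normal_subgroup V -> open (U : set G) ->
  (U : set G) `<=` V -> open V.
Proof.
move=> nV oU UV; apply: open_subgroup_near => //.
have U1 : (U : set G) 1 by have [] := normal_setP U.
exact: filterS (open_nbhs_nbhs (conj oU U1)).
Qed.

(* The congruence [forall a b, K (a * x * b) <-> K (a * b)] is the largest one
   saturating [K]; compactness of [G * G] makes it open when [K] is clopen. *)
Lemma nbhs1_open_subgroup (A : set G) : nbhs (1 : G) A ->
  exists2 U : normalSubgroup G, open (U : set G) & (U : set G) `<=` A.
Proof.
move=> A1.
have zG : zero_dimensional G.
  apply: totally_disconnected_zero_dimensional profinite_totally_disconnected.
    exact: profinite_hausdorff.
  exact: profinite_compact.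
have [K [K1 [oK cK]] KA] :=
  zero_dimensional_cvg (profinite_hausdorff (s := G)) zG profinite_compact A1.
pose N : set G := [set x | forall ab : G * G, K (ab.1 * x * ab.2) <-> K (ab.1 * ab.2)].
have nN : normal_subgroup N.
  split=> [[a b] /=|x y Nx Ny [a b] /=|x y Nx [a b] /=]; first by rewrite mulg1.
    rewrite -(Nx (a, b)) /=; have := Ny (a * (x / y), b).
    by rewrite /= -!mulgA mulKg => ->.
  have := Nx (a * y^-1, y * b); rewrite conjgE /= -!mulgA.
  by rewrite [y^-1 * (y * b)]mulKg.
exists (NormalSubgroup nN) => /=; last first.
  by move=> x /(_ (1, 1)) /=; rewrite mul1g !mulg1 => Kx; apply/KA/Kx.
apply: open_subgroup_near => //.
have cGG : compact [set: G * G].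
  by rewrite -setXTT; apply: compact_setX; exact: profinite_compact.
have /(_ (fun x ab => K (ab.1 * x * ab.2) <-> K (ab.1 * ab.2))) :=
  iffLR (compact_near_coveringP _) cGG _ (nbhs (1 : G)).
move=> cov; apply: filterS (cov _ _) => [x Nx ab|[a b] _]; first exact: Nx.
pose F : set_system ((G * G) * G) := filter_prod (nbhs (a, b)) (nbhs (1 : G)).
have cF : (t.1 @[t --> F]) --> (a, b) by exact: cvg_fst.
have ca : (t.1.1 @[t --> F]) --> a by apply: (cvg_comp _ _ cF); exact: cvg_fst.
have cb : (t.1.2 @[t --> F]) --> b by apply: (cvg_comp _ _ cF); exact: cvg_snd.
have c1 : (t.1.1 * t.2 * t.1.2) @[t --> F] --> a * b.
  rewrite -[a in a * b]mulg1; apply: mulg_cvg cb; apply: mulg_cvg ca _.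
  exact: cvg_snd.
have c2 : (t.1.1 * t.1.2) @[t --> F] --> a * b by exact: mulg_cvg.
suff : F [set t | K (t.1.1 * t.2 * t.1.2) <-> K (t.1.1 * t.1.2)] by [].
(* [K] and its complement are both open, so whichever contains [a * b] contains both products for
   all triples near [((a, b), 1)]. *)
have [Kab|nKab] := pselect (K (a * b)).
  have nK := open_nbhs_nbhs (conj oK Kab).
  have F1 : F [set t | K (t.1.1 * t.2 * t.1.2)] by exact: (c1 _ nK).
  have F2 : F [set t | K (t.1.1 * t.1.2)] by exact: (c2 _ nK).
  by apply: filterS (filterI F1 F2) => t [].
have nK := open_nbhs_nbhs (conj (closed_openC cK) nKab).
have F1 : F [set t | ~ K (t.1.1 * t.2 * t.1.2)] by exact: (c1 _ nK).
have F2 : F [set t | ~ K (t.1.1 * t.1.2)] by exact: (c2 _ nK).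
by apply: filterS (filterI F1 F2) => t [].
Qed.

End OpenSubgroups.

(** * Index *)

(** Finite subsets of [T] directed by inclusion. This filter extracts finite covers from compactness
    in [open_index_le], and the ultrafilters refining it are the regular ones used in
    [ultra_completion_large]. *)
Definition seq_filter (T : eqType) : set_system (seq T) :=
  [set A | exists s : seq T, forall t : seq T, {subset s <= t} -> A t].

Global Instance seq_filter_proper (T : eqType) : ProperFilter (@seq_filter T).
Proof.
split; first by move=> [s /(_ s)]; apply.
split; first by exists [::].
- move=> A B [s sA] [t tB]; exists (s ++ t) => u stu.
  by split; [apply: sA|apply: tB] => x xs; apply: stu; rewrite mem_cat xs ?orbT.
- by move=> A B AB [s sA]; exists s => t /sA /AB.
Qed.

Lemma seq_filter_mem (T : eqType) (x : T) : \forall s \near @seq_filter T, x \in s.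
Proof. by exists [:: x] => t; apply; rewrite mem_head. Qed.

Section Index.
Variable G : groupType.
Implicit Types (U V W : normalSubgroup G) (n k : nat).

Definition index_le U n := (gcosets U #<= `I_n)%card.

Lemma gcoset_coset U x y : gcoset U x y <-> coset U x = coset U y.
Proof. by rewrite gcosetP cosetE. Qed.

(** Colourings of the elements, not necessarily onto, replace cardinalities of sets of cosets in the
    later index arguments. *)
Lemma index_leP U n : index_le U n <->
  exists c : G -> 'I_n, forall x y, c x = c y <-> coset U x = coset U y.
Proof.
rewrite /index_le (card_le_eqr card_II); split.
  move=> /card_leP[f]; exists (fun x => val (f (coset U x))) => x y.
  by split=> [/val_inj /inj|->//]; apply; rewrite inE.
move=> [c cE].
suff /injfunPex[f] : exists2 f : set G -> 'I_n,
    set_fun (gcosets U) [set: 'I_n] f & set_inj (gcosets U) f.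
  exact: inj_card_le.
have r_in (x : G) : gcoset U x (xget 1 (gcoset U x)).
  by apply: (@xgetPex _ 1 (gcoset U x)); exists x; apply/gcoset_coset.
(* A coset is coloured through a chosen element; cosets are nonempty, so the default [1] of [xget]
   is never reached. *)
exists (fun A => c (xget 1 A)) => // A B /set_mem[x _ <-] /set_mem[y _ <-].
move=> /cE rxy; have /gcoset_coset xr := r_in x; have /gcoset_coset yr := r_in y.
by have := congr1 val (etrans xr (etrans rxy (esym yr))).
Qed.

Lemma index_le_exact U n : index_le U n -> exists2 k, (k <= n)%N & has_index U k.
Proof.
move=> Un; have /finite_setP[k Uk] : finite_set (gcosets U).
  by apply/finite_set_leP; exists n.
by exists k => //; rewrite -card_le_II -(card_le_eql Uk).
Qed.

Lemma has_index_le U k n : has_index U k -> (k <= n)%N -> index_le U n.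
Proof. by rewrite /index_le => Uk kn; rewrite (card_le_eql Uk) card_le_II. Qed.

Lemma index_le_finType (T : finType) (c : G -> T) U :
  (forall x y, c x = c y <-> coset U x = coset U y) -> index_le U #|T|.
Proof.
move=> cE; apply/index_leP; exists (fun x => enum_rank (c x)) => x y.
by rewrite -cE; split=> [/enum_rank_inj|->].
Qed.

Lemma index_le_sub U V n : (U : set G) `<=` V -> index_le U n -> index_le V n.
Proof.
move=> UV /index_leP[c cE]; apply/index_leP.
have r_in (x : G) : gcoset V x (xget 1 (gcoset V x)).
  by apply: (@xgetPex _ 1 (gcoset V x)); exists x; apply/gcoset_coset.
exists (fun x => c (xget 1 (gcoset V x))) => x y; split=> [/cE /(coset_sub UV)|xy].
  by have /gcoset_coset <- := r_in x; have /gcoset_coset <- := r_in y.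
by have -> : gcoset V x = gcoset V y by have := congr1 val xy.
Qed.

(** Pigeonhole: representatives of the [k] cosets of [W] have distinct colours modulo [V], hence
    exhaust the [k] colours. So [y] and [1] each share a coset of [V] with a representative, and
    these two representatives agree modulo [W], hence coincide. *)
Lemma index_le_eq V W k : (V : set G) `<=` W -> has_index W k -> index_le V k ->
  (W : set G) `<=` V.
Proof.
move=> VW Wk /index_leP[d dE] y Wy.
have [r rI] : exists r : 'I_k -> G, injective (fun i => coset W (r i)).
  have /card_leP[f] : ([set: 'I_k] #<= gcosets W)%card.
    by rewrite -(card_le_eql card_II) (card_le_eqr Wk).
  have [s sK] := choice (@coset_surj _ W).
  exists (fun i => s (f (SigSub (mem_set (I : [set: 'I_k] i))))) => i j.
  by rewrite !sK => /inj; rewrite !inE => /(_ I I) /(congr1 val).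
have dI : injective (d \o r) by move=> i j /dE /(coset_sub VW) /rI.
have rE z : exists i, d (r i) = d z.
  by exists (invF dI (d z)); exact: (f_invF dI).
have [[i iy] [j j1]] := (rE y, rE 1).
suff ij : i = j.
  by move: iy; rewrite ij j1 => /dE; rewrite coset1 => /esym /coset1P.
apply: rI; move/dE/(coset_sub VW) : iy => ->; move/dE/(coset_sub VW) : j1 => ->.
by rewrite coset1; apply/coset1P.
Qed.

End Index.

Lemma index_le_quot_iso (A B : groupType) (f : A -> B) M N n :
  quot_iso f M N -> index_le N n -> index_le M n.
Proof.
move=> fi /index_leP[c cE]; apply/index_leP; exists (c \o f) => x y /=.
by rewrite cE (quot_iso_coset fi).
Qed.

(** By compactness some finite sequence [s] meets every coset; an element is coloured by the
    position in [s] of the first representative of its coset. *)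
Lemma open_index_le (G : profiniteGroupType) (U : normalSubgroup G) :
  open (U : set G) -> exists n, index_le U n.
Proof.
move=> oU.
have [s sP] : exists s : seq G, forall x, has (fun z => `[< coset U z = coset U x >]) s.
  pose P (s : seq G) x := has (fun z => `[< coset U z = coset U x >]) s.
  have cov : \forall s \near @seq_filter G, [set: G] `<=` P s.
    apply: (iffLR (compact_near_coveringP _) profinite_compact) => x _.
    exists ([set y | coset U y = coset U x], [set s : seq G | x \in s]).
      by split=> /=; [exact: open_subgroup_near1|exact: seq_filter_mem].
    by move=> [y t] /= [yx xt]; apply/hasP; exists x => //; apply/asboolP.
  by have [s sP] := filter_ex cov; exists s => x; exact: sP.
exists (size s); apply/index_leP.
have c_lt x : (find (fun z => `[< coset U z = coset U x >]) s < size s)%N.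
  by rewrite -has_find.
exists (fun x => Ordinal (c_lt x)) => x y; split=> [/(congr1 val) /= xy|xy].
  have /asboolP <- := nth_find 1 (sP x); rewrite xy.
  exact/asboolP/(nth_find 1 (sP y)).
by apply: val_inj; rewrite /= xy.
Qed.

(** * Small groups are determined by their finite quotients *)

Lemma normalSubgroup_eq (G : groupType) (M N : normalSubgroup G) :
  (M : set G) = N -> M = N.
Proof.
case: M N => [M nM] [N nN] /= MN; rewrite MN in nM *.
by congr NormalSubgroup; exact: Prop_irrelevance.
Qed.

Lemma ultra_lim (T : Type) (X : topologicalType) (F : set_system T) (f : T -> X) :
  UltraFilter F -> compact [set: X] -> exists p : X, f @ F --> p.
Proof.
move=> UF cX; have [p [_ clp]] := cX (f @ F) _ filterT.
exists p => A pA; have [//|FnA] := in_ultra_setVsetC (f @^-1` A) UF.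
by have [y [nAy Ay]] := clp (~` A) _ FnA pA.
Qed.

Lemma nbhs_mulg (G : profiniteGroupType) (x : G) (A : set G) :
  nbhs x A -> nbhs (1 : G) [set y | A (x * y)].
Proof.
rewrite -[X in nbhs X]mulg1.
have : (x * y) @[y --> (1 : G)] --> x * 1 by apply: mulg_cvg => //; exact: cvg_cst.
exact.
Qed.

(** * Limits of approximate homomorphisms *)

Definition nbhs1_base (G : profiniteGroupType) (D : nat -> normalSubgroup G) :=
  (forall n, open (D n : set G)) /\
  (forall A, nbhs (1 : G) A -> exists n, (D n : set G) `<=` A).

Lemma nbhs1_base_eq (G : profiniteGroupType) (D : nat -> normalSubgroup G) (x y : G) :
  nbhs1_base D -> (forall n, coset (D n) x = coset (D n) y) -> x = y.
Proof.
move=> [_ bD] xy; apply: profinite_hausdorff => A B xA yB.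
exists y; split; last exact: nbhs_singleton.
have [n nA] := bD _ (nbhs_mulg xA); rewrite -[y](mulVKg x).
by apply: nA; apply/cosetE.
Qed.

(** Each [s n] acts as a homomorphism at all levels [m <= n] simultaneously. Along an ultrafilter
    refining [\oo], almost every [n] is beyond any given level, so the limit is a homomorphism at
    every level. *)
Record approx_hom (G H : profiniteGroupType) (D : nat -> normalSubgroup G)
    (E : nat -> normalSubgroup H) (s : nat -> G -> H) : Prop := ApproxHom {
  approx_hom_coset : forall m n x y, (m <= n)%N -> coset (D m) x = coset (D m) y ->
    coset (E m) (s n x) = coset (E m) (s n y);
  approx_homM : forall m n x y, (m <= n)%N ->
    coset (E m) (s n (x * y)) = coset (E m) (s n x) * coset (E m) (s n y) }.

Section UltraLimit.
Variables (F : set_system nat) (UF : UltraFilter F) (Foo : \oo `<=` F).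

Let F_ge m : \forall n \near F, (m <= n)%N.
Proof. by apply: Foo; exact: nbhs_infty_ge. Qed.

Definition coset_lim (G H : profiniteGroupType) (E : nat -> normalSubgroup H)
    (s : nat -> G -> H) (f : G -> H) :=
  forall x m, \forall n \near F, coset (E m) (s n x) = coset (E m) (f x).

(** Compactness of [H] makes every sequence [s n x] converge along the ultrafilter, so the various
    [s n] need no mutual compatibility. *)
Lemma coset_lim_exists (G H : profiniteGroupType) (E : nat -> normalSubgroup H)
  (s : nat -> G -> H) : nbhs1_base E -> exists f, coset_lim E s f.
Proof.
move=> [oE _].
have [f fP] := choice (fun x => ultra_lim (s^~ x) UF (@profinite_compact H)).
by exists f => x m; exact: (fP x _ (open_subgroup_near1 (f x) (oE m))).
Qed.

Section Limit.
Variables (G H : profiniteGroupType) (D : nat -> normalSubgroup G).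
Variables (E : nat -> normalSubgroup H) (s : nat -> G -> H) (f : G -> H).
Hypotheses (bD : nbhs1_base D) (bE : nbhs1_base E).
Hypotheses (sh : approx_hom D E s) (fs : coset_lim E s f).

(** One index [n >= m] at which [s n] already agrees with [f] modulo [E m] at [x] and [y] suffices.
    [coset_limM] and [coset_lim_cancel] follow the same scheme. *)
Lemma coset_lim_coset m x y : coset (D m) x = coset (D m) y ->
  coset (E m) (f x) = coset (E m) (f y).
Proof.
move=> xy; have [n [[<- <-] mn]] :=
  filter_ex (filterI (filterI (fs x m) (fs y m)) (F_ge m)).
exact: (approx_hom_coset sh mn xy).
Qed.

Lemma coset_limM : {morph f : x y / x * y}.
Proof.
move=> x y; apply: (nbhs1_base_eq bE) => m.
have [n [[[<- fx] fy] mn]] := filter_ex (filterI (filterI (filterI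
  (fs (x * y) m) (fs x m)) (fs y m)) (F_ge m)).
by rewrite cosetM -fx -fy (approx_homM sh).
Qed.

Lemma coset_lim_continuous : continuous f.
Proof.
move=> x A fxA; have [m mA] := bE.2 _ (nbhs_mulg fxA).
rewrite nbhs_simpl /=; apply: filterS (open_subgroup_near1 x (bD.1 m)) => y xy.
have /cosetE/mA/= := esym (coset_lim_coset xy).
by rewrite mulVKg.
Qed.

End Limit.

Lemma coset_lim_cancel (G H : profiniteGroupType) (D : nat -> normalSubgroup G)
    (E : nat -> normalSubgroup H) s t f g :
  nbhs1_base D -> nbhs1_base E -> approx_hom E D t ->
  coset_lim E s f -> coset_lim D t g ->
  (forall m n x, (m <= n)%N -> coset (D m) (t n (s n x)) = coset (D m) x) ->
  cancel f g.
Proof.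
move=> bD bE th fs gt ts x; apply: (nbhs1_base_eq bD) => m.
have [n [[<- fx] mn]] := filter_ex (filterI (filterI (gt (f x) m) (fs x m)) (F_ge m)).
by rewrite -(approx_hom_coset th mn fx) ts.
Qed.

End UltraLimit.

Lemma approx_hom_isomorphic (G H : profiniteGroupType) (D : nat -> normalSubgroup G)
    (E : nat -> normalSubgroup H) s t :
  nbhs1_base D -> nbhs1_base E -> approx_hom D E s -> approx_hom E D t ->
  (forall m n x, (m <= n)%N -> coset (D m) (t n (s n x)) = coset (D m) x) ->
  (forall m n y, (m <= n)%N -> coset (E m) (s n (t n y)) = coset (E m) y) ->
  topgroup_isomorphic G H.
Proof.
move=> bD bE sh th ts st.
have [F [UF Foo]] := ultraFilterLemma (@eventually_filter).
have [f fs] := coset_lim_exists UF s bE.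
have [g gt] := coset_lim_exists UF t bD.
exists f, g; split.
- exact: (coset_limM UF Foo bE sh fs).
- exact: (coset_lim_continuous UF Foo bD bE sh fs).
- exact: (coset_lim_continuous UF Foo bE bD th gt).
- exact: (coset_lim_cancel UF Foo bD bE th fs gt ts).
- exact: (coset_lim_cancel UF Foo bE bD sh gt fs st).
Qed.

(** * Cores and their behaviour under isomorphisms of quotients *)

Section Core.
Variable G : profiniteGroupType.
Implicit Types (U V : normalSubgroup G) (n : nat).

(** Bounding the index by [n], instead of prescribing it, makes the cores decrease with [n]. *)
Definition core_set n : set G :=
  [set x | forall U, open (U : set G) -> index_le U n -> (U : set G) x].

Lemma core_subproof n : normal_subgroup (core_set n).
Proof.
split=> [U|x y cx cy U oU Un|x y cx U oU Un]; have [U1 UF UJ] := normal_setP U => //.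
- by apply: UF; [exact: cx|exact: cy].
- by apply: UJ; exact: cx.
Qed.

Definition core n := NormalSubgroup (core_subproof n).

Lemma core_sub m n : (m <= n)%N -> (core n : set G) `<=` core m.
Proof.
move=> mn x cx U oU Um; apply: cx => //.
by apply: card_le_trans Um _; rewrite card_le_II.
Qed.

Lemma small_core_open n : small G -> open (core n : set G).
Proof.
move=> sG; apply: open_subgroup_near; first exact: normal_setP.
(* Smallness concerns one exact index at a time, so the indices [k <= n] are collected; the range is
   strict, whence [n.+1]. *)
pose S := \bigcup_(k in `I_n.+1)
  [set U : set G | [/\ normal_subgroup U, open U & has_index U k]].
have fS : finite_set S by apply: bigcup_finite => // k _; exact: sG.
have : nbhs (1 : G) (\bigcap_(U in S) U).
  have [X SX] := (iffLR finite_fsetP) fS; rewrite SX.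
  apply: filter_bigI => U UX; have : S U by rewrite SX.
  by move=> [k _ [[U1 _ _] oU _]]; apply: open_nbhs_nbhs.
apply: filterS => x Sx U oU Un; have [k kn Uk] := index_le_exact Un.
apply: Sx; exists k => //=; split=> //; exact: normal_setP.
Qed.

Lemma core_base : (forall n, open (core n : set G)) -> nbhs1_base core.
Proof.
move=> oc; split=> // A A1; have [U oU UA] := nbhs1_open_subgroup A1.
by have [n Un] := open_index_le oU; exists n => x cx; apply/UA/cx.
Qed.

End Core.

Section CoreIso.
Variables (G H : profiniteGroupType) (n : nat).
Hypotheses (oG : open (core G n : set G)).

(** An open normal [V] of index at most [m] contains [core H n]. Its preimage under [f] is thus
    normal of index at most [m], and open because it contains [core G n]; so it contains
    [core G m]. *)
Lemma core_quot_iso m f x : (m <= n)%N -> quot_iso f (core G n) (core H n) ->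
  (core G m : set G) x -> (core H m : set H) (f x).
Proof.
move=> mn fi cx V oV Vm.
have [|U [UE cU Ui]] := quot_iso_preim fi (N' := V).
  by move=> y cy; apply: (core_sub mn cy).
rewrite -[_ (f x)]/((f @^-1` V) x) -UE; apply: cx.
  by apply: open_subgroup_sub oG cU; exact: normal_setP.
exact: index_le_quot_iso Ui Vm.
Qed.

Lemma core_quot_iso_coset m f x y : (m <= n)%N -> quot_iso f (core G n) (core H n) ->
  coset (core G m) x = coset (core G m) y ->
  coset (core H m) (f x) = coset (core H m) (f y).
Proof.
move=> mn fi /cosetE/(core_quot_iso mn fi)/coset1P.
have -> : coset (core H m) (f (x^-1 * y)) = coset (core H m) ((f x)^-1 * f y).
  apply: coset_sub (core_sub mn) _.
  by rewrite (quot_isoM fi) (quot_isoV _ fi) cosetM cosetV.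
by move=> /coset1P/cosetE.
Qed.

Lemma core_quot_isoM m f x y : (m <= n)%N -> quot_iso f (core G n) (core H n) ->
  coset (core H m) (f (x * y)) = coset (core H m) (f x) * coset (core H m) (f y).
Proof.
move=> mn fi; rewrite -cosetM; apply: coset_sub (core_sub mn) _.
by rewrite (quot_isoM fi) cosetM.
Qed.

End CoreIso.

Lemma fin_quot_iso (G H : profiniteGroupType) (U : normalSubgroup G) :
  fin G = fin H -> open (U : set G) ->
  exists (V : normalSubgroup H) (f : G -> H), open (V : set H) /\ quot_iso f U V.
Proof.
move=> GH oU; have : fin G (iso_class (quotient_group U)) by exists U.
rewrite GH => -[V oV /iso_classP /quot_isoP[f fi]]; by exists V, f.
Qed.

Lemma normal_subgroupI (G : groupType) (M N : normalSubgroup G) :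
  normal_subgroup ((M : set G) `&` N).
Proof.
have [[M1 MF MJ] [N1 NF NJ]] := (normal_setP M, normal_setP N).
split=> // [x y [Mx Nx] [My Ny]|x y [Mx Nx]]; split.
- exact: MF.
- exact: NF.
- exact: MJ.
- exact: NJ.
Qed.

(* Any [W] with [H / W] isomorphic to [G / core G n] equals [core H n]: it is an
   intersection of open normal subgroups of index at most [n], and no such
   intersection can have index larger than that of [core G n]. *)
Lemma core_fin_quot_iso (G H : profiniteGroupType) n :
  fin G = fin H -> open (core G n : set G) ->
  open (core H n : set H) /\ exists f, quot_iso f (core G n) (core H n).
Proof.
move=> GH oc; have [W [s [oW si]]] := fin_quot_iso GH oc.
have [t [ti _]] := quot_iso_sym si.
(* [W] is the intersection of the preimages under [t] of the open normal subgroups of [G] of index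
   at most [n], and these preimages have index at most [n] in [H]. *)
have cW : (core H n : set H) `<=` W.
  move=> y cy; apply/(quot_iso_mem _ ti) => U oU Un.
  have [|V [VE WV Vi]] := quot_iso_preim ti (N' := U); first by move=> x; apply.
  rewrite -[_ (t y)]/((t @^-1` U) y) -VE; apply: cy.
    by apply: open_subgroup_sub oW WV; exact: normal_setP.
  exact: index_le_quot_iso Vi Un.
have Wc : (W : set H) `<=` core H n.
  move=> y Wy V oV Vn; pose V1 := NormalSubgroup (normal_subgroupI V W).
  have oV1 : open (V1 : set H) by exact: openI.
  have [U [t' [oU ti']]] := fin_quot_iso (esym GH) oV1.
  have [s' [si' _]] := quot_iso_sym ti'.
  have cU_of (K : normalSubgroup H) x : (V1 : set H) `<=` K -> index_le K n ->
      (core G n : set G) x -> (K : set H) (s' x).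
    move=> VK Kn cx; have [L [LE UL Li]] := quot_iso_preim si' VK.
    rewrite -[_ (s' x)]/((s' @^-1` K) x) -LE; apply: cx.
      by apply: open_subgroup_sub oU UL; exact: normal_setP.
    exact: index_le_quot_iso Li Kn.
  (* [V1] is an intersection of open normal subgroups of index at most [n]: [V] and the preimages
     under [t] that cut out [W]. Pulled back by [s'], they all contain [core G n]. *)
  have cU : (core G n : set G) `<=` U.
    move=> x cx; apply/(quot_iso_mem _ si'); split.
      by apply: cU_of cx => // z [].
    apply/(quot_iso_mem _ ti) => K oK Kn.
    have [|L [LE WL Li]] := quot_iso_preim ti (N' := K); first by move=> z; apply.
    rewrite -[_ (t _)]/((t @^-1` K) (s' x)) -LE; apply: cU_of cx.
      by move=> z [_ /WL].
    exact: index_le_quot_iso Li Kn.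
  (* The index of [V1] equals that of [U], which is at most that of [core G n], that is, the index
     [k] of [W]; since [V1] lies in [W], they are equal. *)
  have [_ /index_le_exact [k _ Wk]] := open_index_le oW.
  suff : (W : set H) `<=` V1 by move=> /(_ y Wy) [].
  apply: (index_le_eq _ Wk); first by move=> z [].
  apply: index_le_quot_iso ti' _; apply: index_le_sub cU _.
  by apply: index_le_quot_iso si _; apply: has_index_le Wk _.
have <- : W = core H n by apply: normalSubgroup_eq; apply/seteqP.
by split=> //; exists s.
Qed.

Lemma small_isomorphic (G H : profiniteGroupType) :
  small G -> fin G = fin H -> topgroup_isomorphic G H.
Proof.
move=> sG GH; have oG n := small_core_open n sG.
(* Smallness is assumed of [G] alone; openness of the cores of [H] is transported from [G]. *)
have oH n := (core_fin_quot_iso GH (oG n)).1.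
have [s si] := choice (fun n => (core_fin_quot_iso GH (oG n)).2).
have [t tP] := choice (fun n => quot_iso_sym (si n)).
apply: (@approx_hom_isomorphic G H (core G) (core H) s t).
- exact: core_base.
- exact: core_base.
- split=> m n x y mn; first exact: (core_quot_iso_coset (oG n) mn (si n)).
  exact: (core_quot_isoM _ _ mn (si n)).
- split=> m n x y mn; first exact: (core_quot_iso_coset (oH n) mn (tP n).1).
  exact: (core_quot_isoM _ _ mn (tP n).1).
- by move=> m n x mn; apply: coset_sub (core_sub mn) _; exact: (tP n).2.2.
- by move=> m n x mn; apply: coset_sub (core_sub mn) _; exact: (tP n).2.1.
Qed.

(** * Profinite completions *)

Lemma ultra_finType (T : Type) (F : set_system T) (I : finType) (f : T -> I) :
  UltraFilter F -> exists i, \forall t \near F, f t = i.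
Proof.
move=> UF; apply: contrapT => /forallNP Nf.
have : \forall t \near F, forall i, f t <> i.
  apply: filter_forall => i.
  by have [/Nf|] := in_ultra_setVsetC [set t | f t = i] UF.
by move=> /filter_ex[t /(_ (f t))].
Qed.

Lemma ultra_quotient (A : groupType) (N : normalSubgroup A) n (T : Type)
    (F : set_system T) (f : T -> quotient_group N) :
  UltraFilter F -> index_le N n -> exists q, \forall t \near F, f t = q.
Proof.
move=> UF /index_leP[c cE]; have [r rK] := choice (@coset_surj _ N).
have [i Fi] := ultra_finType (c \o r \o f) UF.
have [t ti] := filter_ex Fi; exists (f t); apply: filterS Fi => u /= ui.
by rewrite -[LHS]rK -[RHS]rK; apply/cE; rewrite ui.
Qed.

Record normal_system (A : groupType) := NormalSystem {
  sys_index : Type;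
  sys_sub :> sys_index -> normalSubgroup A;
  sys_inhabited : inhabited sys_index;
  sys_directed : forall i j, exists k,
    (sys_sub k : set A) `<=` sys_sub i /\ (sys_sub k : set A) `<=` sys_sub j;
  sys_finite : forall i, exists n, index_le (sys_sub i) n }.

(** The inverse limit of the finite quotients [A / S i]. Stating compatibility through
    representatives [x] in [A] avoids transition maps between quotients. *)
Record completion (A : groupType) (S : normal_system A) := Completion {
  cproj : forall i, quotient_group (S i);
  cproj_compat : forall i j x, (S i : set A) `<=` S j ->
    coset (S i) x = cproj i -> coset (S j) x = cproj j }.

Section Completion.
Variables (A : groupType) (S : normal_system A).
Local Notation H := (completion S).
Implicit Types (a b c : H) (x : A).

Lemma completion_ext a b : (forall i, cproj a i = cproj b i) -> a = b.
Proof.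
case: a b => [a ca] [b cb] /= ab.
have {}ab : a = b by exact: functional_extensionality_dep.
by rewrite ab in ca *; congr Completion; exact: Prop_irrelevance.
Qed.

Program Definition completion_of x : H := @Completion A S (fun i => coset (S i) x) _.
Next Obligation. by move=> x i j y Sij; exact: coset_sub. Qed.

Program Definition completion_mul a b : H :=
  @Completion A S (fun i => cproj a i * cproj b i) _.
Next Obligation.
move=> a b i j z Sij; have [x xa] := coset_surj (cproj a i).
have [y yb] := coset_surj (cproj b i).
rewrite -xa -yb -cosetM => /(coset_sub Sij) ->.
by rewrite cosetM (cproj_compat Sij xa) (cproj_compat Sij yb).
Qed.

Program Definition completion_inv a : H := @Completion A S (fun i => (cproj a i)^-1) _.
Next Obligation.
move=> a i j z Sij; have [x xa] := coset_surj (cproj a i).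
rewrite -xa -cosetV => /(coset_sub Sij) ->.
by rewrite cosetV (cproj_compat Sij xa).
Qed.

Let completion_one := completion_of 1.

HB.instance Definition _ := gen_eqMixin H.
HB.instance Definition _ := gen_choiceMixin H.

Lemma completion_mulA : associative completion_mul.
Proof. by move=> a b c; apply: completion_ext => i /=; rewrite mulgA. Qed.

Lemma completion_mul1 : left_id completion_one completion_mul.
Proof. by move=> a; apply: completion_ext => i /=; rewrite coset1 mul1g. Qed.

Lemma completion_mulr1 : right_id completion_one completion_mul.
Proof. by move=> a; apply: completion_ext => i /=; rewrite coset1 mulg1. Qed.

Lemma completion_mulV : left_inverse completion_one completion_inv completion_mul.
Proof. by move=> a; apply: completion_ext => i /=; rewrite coset1 mulVg. Qed.

Lemma completion_mulrV : right_inverse completion_one completion_inv completion_mul.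
Proof. by move=> a; apply: completion_ext => i /=; rewrite coset1 mulgV. Qed.

HB.instance Definition _ := isGroup.Build H completion_mulA completion_mul1
  completion_mulr1 completion_mulV completion_mulrV.

Lemma cprojM a b i : cproj (a * b) i = cproj a i * cproj b i. Proof. by []. Qed.

Lemma cprojV a i : cproj a^-1 i = (cproj a i)^-1. Proof. by []. Qed.

Lemma cproj1 i : cproj (1 : H) i = 1. Proof. exact: coset1. Qed.

(** The inverse limit topology: since the system is directed, conditions on single coordinates
    already form a filter base. *)
Definition completion_nbhs a : set_system H :=
  [set B | exists i, forall b, cproj b i = cproj a i -> B b].

HB.instance Definition _ := hasNbhs.Build H completion_nbhs.

Lemma completion_nbhsE a (B : set H) :
  nbhs a B <-> exists i, forall b, cproj b i = cproj a i -> B b.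
Proof. by []. Qed.

Lemma cproj_sub i j a b : (S i : set A) `<=` S j -> cproj a i = cproj b i ->
  cproj a j = cproj b j.
Proof.
move=> Sij; have [x xa] := coset_surj (cproj a i) => ab.
by rewrite -(cproj_compat Sij xa); apply: cproj_compat Sij _; rewrite xa.
Qed.

Lemma completion_nbhs_filter a : ProperFilter (nbhs a).
Proof.
split; first by move=> /completion_nbhsE[i /(_ a)]; apply.
split.
- by have [i] := sys_inhabited S; apply/completion_nbhsE; exists i.
- move=> B C /completion_nbhsE[i iB] /completion_nbhsE[j jC].
  have [k [ki kj]] := sys_directed i j.
  apply/completion_nbhsE; exists k => b ba.
  by split; [apply: iB|apply: jC]; exact: cproj_sub ba.
- move=> B C BC /completion_nbhsE[i iB].
  by apply/completion_nbhsE; exists i => b /iB /BC.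
Qed.

Lemma completion_nbhs_singleton a (B : set H) : nbhs a B -> B a.
Proof. by move=> /completion_nbhsE[i]; apply. Qed.

Lemma completion_nbhs_nbhs a (B : set H) : nbhs a B -> nbhs a (nbhs^~ B).
Proof.
move=> /completion_nbhsE[i iB]; apply/completion_nbhsE; exists i => b ba.
by apply/completion_nbhsE; exists i => c cb; apply: iB; rewrite cb.
Qed.

HB.instance Definition _ := Nbhs_isNbhsTopological.Build H completion_nbhs_filter
  completion_nbhs_singleton completion_nbhs_nbhs.

Lemma cproj_near a i : \forall b \near a, cproj b i = cproj a i.
Proof. by apply/completion_nbhsE; exists i. Qed.

Lemma completion_mul_continuous : continuous (fun ab : H * H => ab.1 * ab.2).
Proof.
move=> [a b] B /completion_nbhsE[i iB].
exists ([set c | cproj c i = cproj a i], [set c | cproj c i = cproj b i]).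
  by split; exact: cproj_near.
by move=> [c d] /= [ca db]; apply: iB; rewrite !cprojM ca db.
Qed.

Lemma completion_inv_continuous : continuous (fun a : H => a^-1).
Proof.
move=> a B /completion_nbhsE[i iB]; apply/completion_nbhsE; exists i => b ba.
by apply: iB; rewrite !cprojV ba.
Qed.

HB.instance Definition _ := Group_isTopologicalGroup.Build H
  completion_mul_continuous completion_inv_continuous.

Lemma completion_clopen i (q : quotient_group (S i)) :
  clopen [set a : H | cproj a i = q].
Proof.
split; first by rewrite openE => a <-; exact: cproj_near.
by move=> a /(_ _ (cproj_near a i)) [b [<- ->]].
Qed.

Lemma completion_hausdorff : hausdorff_space H.
Proof.
move=> a b ab; apply: completion_ext => i.
by have [c [<- <-]] := ab _ _ (cproj_near a i) (cproj_near b i).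
Qed.

Lemma completion_totally_disconnected : totally_disconnected [set: H].
Proof.
apply: zero_dimension_totally_disconnected => a b ab.
have [i abi] : exists i, cproj b i <> cproj a i.
  apply/existsNP => abE; move/eqP: ab; apply.
  by apply: completion_ext => i; rewrite abE.
by exists [set c | cproj c i = cproj a i]; split=> //; exact: completion_clopen.
Qed.

(** Along an ultrafilter each coordinate, having finitely many values, is almost surely constant.
    Any two coordinates take these values simultaneously at some point, so the values are compatible
    and define the limit. *)
Lemma completion_compact : compact [set: H].
Proof.
rewrite compact_ultra => F UF _.
have Fe : forall i, exists q, \forall a \near F, cproj a i = q.
  by move=> i; have [n Sn] := sys_finite i; exact: ultra_quotient UF Sn.
have [q Fq] := all_sig (fun i => cid (Fe i)).
have qc i j x : (S i : set A) `<=` S j -> coset (S i) x = q i -> coset (S j) x = q j.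
  move=> Sij; have [a [<- <-]] := filter_ex (filterI (Fq i) (Fq j)).
  exact: cproj_compat.
exists (Completion qc); split=> // B /completion_nbhsE[i iB].
by apply: filterS (Fq i) => b; exact: iB.
Qed.

HB.instance Definition _ := TopologicalGroup_isProfinite.Build H
  completion_compact completion_hausdorff completion_totally_disconnected.

Section Kernel.
Variable i : sys_index S.

Definition cker_set : set H := [set a | cproj a i = 1].

Lemma cker_subproof : normal_subgroup cker_set.
Proof.
split=> [|a b a1 b1|a b a1]; first exact: cproj1.
  suff : cproj (a / b) i = 1 by [].
  by rewrite cprojM cprojV a1 b1 mulgV.
suff : cproj (a ^ b) i = 1 by [].
by rewrite conjgE !cprojM cprojV a1 mul1g mulVg.
Qed.

Definition cker := NormalSubgroup cker_subproof.

Lemma cker_open : open (cker : set H).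
Proof. exact: (completion_clopen _).1. Qed.

Lemma coset_cker a b : coset cker a = coset cker b <-> cproj a i = cproj b i.
Proof.
rewrite cosetE -[X in X <-> _]/(cproj (a^-1 * b) i = 1) cprojM cprojV.
split=> [ab1|->]; last exact: mulVg.
by apply: (mulgI (cproj a i)^-1); rewrite ab1 mulVg.
Qed.

Lemma cker_quot_iso : quot_iso completion_of (S i) cker.
Proof.
split=> [x y|x y|a]; first by rewrite coset_cker.
  by rewrite -cosetM; apply/coset_cker; rewrite cprojM /= cosetM.
by have [x xa] := coset_surj (cproj a i); exists x; apply/coset_cker.
Qed.

End Kernel.

(** [V] contains the kernel of some projection, so the correspondence theorem applies to the
    isomorphism of [A / S i] with the quotient by that kernel. *)
Lemma completion_open_quot_iso (V : normalSubgroup H) : open (V : set H) ->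
  exists i (M : normalSubgroup A),
    (S i : set A) `<=` M /\ quot_iso completion_of M V.
Proof.
move=> oV; have V1 : (V : set H) 1 by have [] := normal_setP V.
have /completion_nbhsE[i iV] := open_nbhs_nbhs (conj oV V1).
have [|M [_ SM Mi]] := quot_iso_preim (cker_quot_iso i) (N' := V).
  by move=> a ai; apply: iV; rewrite cproj1.
by exists i, M.
Qed.

End Completion.

(** * Ultraproducts *)

Definition fun_group (I : Type) (G : groupType) : Type := I -> G.

Section FunGroup.
Variables (I : Type) (G : groupType).
Implicit Types g h : fun_group I G.

HB.instance Definition _ := gen_eqMixin (fun_group I G).
HB.instance Definition _ := gen_choiceMixin (fun_group I G).

Let one : fun_group I G := fun=> 1.
Let mul g h : fun_group I G := fun i => g i * h i.
Let inv g : fun_group I G := fun i => (g i)^-1.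

Lemma fun_mulgA : associative mul.
Proof. by move=> f g h; apply: funext => i; rewrite /mul mulgA. Qed.

Lemma fun_mul1g : left_id one mul.
Proof. by move=> g; apply: funext => i; rewrite /mul mul1g. Qed.

Lemma fun_mulg1 : right_id one mul.
Proof. by move=> g; apply: funext => i; rewrite /mul mulg1. Qed.

Lemma fun_mulVg : left_inverse one inv mul.
Proof. by move=> g; apply: funext => i; rewrite /mul /inv mulVg. Qed.

Lemma fun_mulgV : right_inverse one inv mul.
Proof. by move=> g; apply: funext => i; rewrite /mul /inv mulgV. Qed.

HB.instance Definition _ := isGroup.Build (fun_group I G)
  fun_mulgA fun_mul1g fun_mulg1 fun_mulVg fun_mulgV.

End FunGroup.

Section Ultraproduct.
Variables (I : Type) (G : groupType) (F : set_system I).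
Implicit Types (U : I -> normalSubgroup G) (g h : fun_group I G).

(** The kernel of the map from the power of [G] onto the ultraproduct of the quotients [G / U i]. *)
Definition near_set U : set (fun_group I G) :=
  [set g | \forall i \near F, (U i : set G) (g i)].

Hypothesis UF : UltraFilter F.

Lemma near_subproof U : normal_subgroup (near_set U).
Proof.
split=> [|g h Ug Uh|g h Ug].
- by apply: filterE => i; have [] := normal_setP (U i).
- apply: filterS (filterI Ug Uh) => i [gi hi].
  by have [_ UF' _] := normal_setP (U i); exact: UF'.
- by apply: filterS Ug => i gi; have [_ _ UJ] := normal_setP (U i); exact: UJ.
Qed.

Definition near_subgroup U := NormalSubgroup (near_subproof U).

Lemma coset_near U g h : coset (near_subgroup U) g = coset (near_subgroup U) h <->
  \forall i \near F, coset (U i) (g i) = coset (U i) (h i).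
Proof.
rewrite cosetE /= /near_set /=.
by split; apply: filterS => i /cosetE.
Qed.

(* A multiplication table on ['I_n] determines a group up to isomorphism and there
   are finitely many of them, so one table is that of [G / U i] for almost all [i]. *)
Lemma near_subgroup_quot_iso U n : (forall i, index_le (U i) n) ->
  exists i f, quot_iso f (near_subgroup U) (U i).
Proof.
move=> Un; have [c cE] := choice (fun i => iffLR (index_leP (U i) n) (Un i)).
pose T i := [ffun p : 'I_n * 'I_n * 'I_n =>
  `[< exists x y, p = (c i x, c i y, c i (x * y)) >]].
have [T0 FT0] := ultra_finType T UF.
have [i0 Ti0] := filter_ex FT0.
have tr i x y : T i = T0 -> exists x' y', [/\ c i0 x' = c i x, c i0 y' = c i y &
    c i0 (x' * y') = c i (x * y)].
  move=> Ti; have : T i (c i x, c i y, c i (x * y)).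
    by rewrite ffunE; apply/asboolP; exists x, y.
  by rewrite Ti -Ti0 ffunE => /asboolP[x' [y' [-> -> ->]]]; exists x', y'.
(* As [c i] need not be onto, the table must also tell which colours occur; the entry for [z * z]
   exhibits the colour of [z]. *)
have tr0 i z : T i = T0 -> exists x, c i x = c i0 z.
  move=> Ti; have : T i0 (c i0 z, c i0 z, c i0 (z * z)).
    by rewrite ffunE; apply/asboolP; exists z, z.
  by rewrite Ti0 -Ti ffunE => /asboolP[x [y [-> _ _]]]; exists x.
(* [p g] is the colour of [g i] for almost all [i], and [f g] is an element with that colour for
   [c i0]. *)
have [p pP] := choice (fun g : fun_group I G => ultra_finType (fun i => c i (g i)) UF).
have /choice[f fP] : forall g, exists x, c i0 x = p g.
  move=> g; have [i [<- Ti]] := filter_ex (filterI (pP g) FT0).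
  by have [x [_ [xg _ _]]] := tr i (g i) 1 Ti; exists x.
exists i0, f; split=> [g h|g h|z].
- rewrite -cE !fP coset_near; split=> [gh|gh].
    by apply: filterS (filterI (pP g) (pP h)) => i [gi hi]; rewrite -cE gi hi.
  by have [i [[<- <-] /cE]] := filter_ex (filterI (filterI (pP g) (pP h)) gh).
- have [i [[[gi hi] ghi] Ti]] := filter_ex (filterI (filterI (filterI
    (pP g) (pP h)) (pP (g * h))) FT0).
  have [x [y [xg yh xy]]] := tr i (g i) (h i) Ti.
  have -> : coset (U i0) (f (g * h)) = coset (U i0) (x * y).
    by apply/cE; rewrite fP xy.
  by rewrite cosetM; congr (_ * _); apply/cE; rewrite fP ?xg ?yh.
- have /choice[g gP] : forall i, exists x, T i = T0 -> c i x = c i0 z.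
    (* The value [1] is a filler, used only where the table is not [T0], hence off a set of [F]. *)
    move=> i; have [Ti|nTi] := pselect (T i = T0); last by exists 1.
    by have [x xz] := tr0 i z Ti; exists x.
  exists g; apply/cE; rewrite fP.
  by have [i [<- /gP]] := filter_ex (filterI (pP g) FT0).
Qed.

End Ultraproduct.

Lemma index_leI (G : groupType) (U V : normalSubgroup G) m n :
  index_le U m -> index_le V n ->
  index_le (NormalSubgroup (normal_subgroupI U V)) #|{: 'I_m * 'I_n}|.
Proof.
move=> /index_leP[c cE] /index_leP[d dE].
apply: (@index_le_finType _ _ (fun x => (c x, d x))) => x y.
split=> [[/cE/cosetE Uxy /dE/cosetE Vxy]|/cosetE[/cosetE/cE -> /cosetE/dE ->//]].
exact/cosetE.
Qed.

Lemma fin_eq (G H : profiniteGroupType) :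
  (forall U : normalSubgroup G, open (U : set G) -> exists (V : normalSubgroup H) f,
    open (V : set H) /\ quot_iso f U V) ->
  (forall V : normalSubgroup H, open (V : set H) -> exists (U : normalSubgroup G) f,
    open (U : set G) /\ quot_iso f U V) ->
  fin G = fin H.
Proof.
move=> GH HG; apply: funext => C; apply: propext; split=> -[U oU ->].
  have [V [f [oV fi]]] := GH U oU; exists V => //.
  by apply/iso_classP/quot_isoP; exists f.
have [V [f [oV fi]]] := HG U oU; exists V => //.
by apply/esym/iso_classP/quot_isoP; exists f.
Qed.

(** * Completion of a power along an ultrafilter *)

Section UltraCompletion.
Variables (G : profiniteGroupType) (I : Type) (F : set_system I).
Hypothesis UF : UltraFilter F.

Record bounded_family := BoundedFamily {
  bfam :> I -> normalSubgroup G;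
  bfam_open : forall i, open (bfam i : set G);
  bfam_index : exists n, forall i, index_le (bfam i) n }.

Lemma const_family_subproof (U : normalSubgroup G) : open (U : set G) ->
  exists n, forall _ : I, index_le U n.
Proof. by move=> /open_index_le[n Un]; exists n. Qed.

Definition const_family (U : normalSubgroup G) (oU : open (U : set G)) :=
  @BoundedFamily (fun=> U) (fun=> oU) (const_family_subproof oU).

Lemma setT_normal : normal_subgroup [set: G]. Proof. by []. Qed.

Lemma bounded_family_inhabited : inhabited bounded_family.
Proof. by constructor; apply: (@const_family (NormalSubgroup setT_normal)); exact: openT. Qed.

Definition near_family (U : bounded_family) := near_subgroup UF U.

Lemma near_family_directed U V : exists W,
  (near_family W : set (fun_group I G)) `<=` near_family U /\
  (near_family W : set (fun_group I G)) `<=` near_family V.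
Proof.
pose W i := NormalSubgroup (normal_subgroupI (U i) (V i)).
have oW i : open (W i : set G) by apply: openI; exact: bfam_open.
have Wn : exists n, forall i, index_le (W i) n.
  have [[m Um] [n Vn]] := (bfam_index U, bfam_index V).
  by exists #|{: 'I_m * 'I_n}| => i; exact: index_leI.
by exists (BoundedFamily oW Wn); split=> g; apply: filterS => i [].
Qed.

Lemma near_family_quot_iso U : exists i f, quot_iso f (near_family U) (U i).
Proof. by have [n Un] := bfam_index U; exact: near_subgroup_quot_iso Un. Qed.

Lemma near_family_index U : exists n, index_le (near_family U) n.
Proof.
have [i [f fi]] := near_family_quot_iso U; have [n Un] := bfam_index U.
by exists n; apply: index_le_quot_iso fi _.
Qed.

Definition ultra_system := NormalSystem bounded_family_inhabited
  near_family_directed near_family_index.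

Definition ultra_completion : profiniteGroupType := completion ultra_system.

(** A quotient [G / U] is realised by the constant family [U]. Conversely an open [V] comes from
    some [M] containing [near_family U], and the isomorphism of that quotient with [G / U i] carries
    [M] to an open normal subgroup of [G]. *)
Lemma fin_ultra_completion : fin G = fin ultra_completion.
Proof.
apply: fin_eq => [U oU|V oV].
  have [i [f /quot_iso_sym[g [gi _]]]] := near_family_quot_iso (const_family oU).
  exists (cker (S := ultra_system) (const_family oU)), (completion_of ultra_system \o g).
  split; first exact: cker_open.
  exact: quot_iso_comp gi (cker_quot_iso (S := ultra_system) (const_family oU)).
have [U [M [UM Mi]]] := completion_open_quot_iso oV.
have [i [f /quot_iso_sym[g [gi _]]]] := near_family_quot_iso U.
have [W [_ UW Wi]] := quot_iso_preim gi UM.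
exists W, (completion_of ultra_system \o g); split.
  by apply: open_subgroup_sub (bfam_open U i) UW; exact: normal_setP.
exact: quot_iso_comp Wi Mi.
Qed.

End UltraCompletion.

(** * Groups that are not small *)

Lemma Cantor_powerset (T : Type) (f : set T -> T) : ~ injective f.
Proof.
move=> fI; pose D := [set x | exists2 A, f A = x & ~ A x].
have nD : ~ D (f D) by move=> /[dup] Df [A /fI ->]; exact.
by apply: (nD); exists D.
Qed.

Lemma not_small_injection (G : profiniteGroupType) : ~ small G ->
  exists n (e : nat -> normalSubgroup G),
    [/\ forall k, open (e k : set G), forall k, index_le (e k) n &
        forall k l, (e k : set G) = e l -> k = l].
Proof.
move=> /existsNP[n /infiniteP/card_leP[f]]; exists n.
pose s k := f (SigSub (mem_set (I : [set: nat] k))).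
have sP k : [/\ normal_subgroup (val (s k)), open (val (s k)) & has_index (val (s k)) n].
  exact: set_valP (s k).
have nS k : normal_subgroup (val (s k)) by have [] := sP k.
exists (fun k => NormalSubgroup (nS k)); split=> [k|k|k l /= kl].
- by have [] := sP k.
- by have [_ _ sn] := sP k; exact: (@has_index_le _ (NormalSubgroup (nS k)) _ _ sn).
- by move/val_inj: kl => /inj; rewrite !inE => /(_ I I) /(congr1 val).
Qed.

(* Each element of [T] is sent to a family of subgroups indexed by the finite
   sequences over [T]; distinct elements give families that differ at every sequence
   containing both. *)
Lemma ultra_completion_large (G : profiniteGroupType) (T : eqType)
    (F : set_system (seq T)) (UF : UltraFilter F) :
  ~ small G -> @seq_filter T `<=` F ->
  exists u : T -> set (ultra_completion G UF), injective u.
Proof.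
move=> /not_small_injection[n [e [eo en eI]]] TF.
pose w x (s : seq T) := e (index x s).
have wo x s : open (w x s : set G) by exact: eo.
have wn x : exists n, forall s, index_le (w x s) n by exists n => s; exact: en.
pose W x := BoundedFamily (wo x) (wn x).
exists (fun x => cker (S := ultra_system G UF) (W x) : set _) => x y xy.
apply/eqP; apply: contrapT => /negP nxy.
(* [g s] is taken in exactly one of [w x s] and [w y s] whenever [s] contains both [x] and [y]. *)
have /choice[g gP] : forall s : seq T, exists z, x \in s -> y \in s ->
    ~ ((w x s : set G) z <-> (w y s : set G) z).
  move=> s; apply: contrapT => /forallNP sz.
  have [xs ys] : x \in s /\ y \in s.
    by split; apply: contrapT => nxs; apply: (sz 1) => ? ?.
  have /eI : (w x s : set G) = w y s.
    apply/seteqP; split=> z; apply: contraPP => nz wz; apply: (sz z) => _ _; tauto.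
  by move=> /(congr1 (nth x s)); rewrite !nth_index // => xE; rewrite xE eqxx in nxy.
have Fg : \forall s \near F, ~ ((w x s : set G) (g s) <-> (w y s : set G) (g s)).
  apply: filterS (filterI (TF _ (seq_filter_mem x)) (TF _ (seq_filter_mem y))).
  by move=> s [xs ys]; exact: gP.
have kerE z : (cker (S := ultra_system G UF) (W z) : set _)
    (completion_of _ (g : fun_group (seq T) G)) <->
    \forall s \near F, (w z s : set G) (g s).
  exact: (quot_iso_mem _ (cker_quot_iso (S := ultra_system G UF) (W z))).
have xyE : (\forall s \near F, (w x s : set G) (g s)) <->
    (\forall s \near F, (w y s : set G) (g s)) by rewrite -!kerE xy.
(* The ultrafilter decides whether [g] lies in the kernel for [x]. Equal kernels would place [g] in
   both or in neither, against [Fg]. *)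
have [Fx|nFx] := in_ultra_setVsetC [set s | (w x s : set G) (g s)] UF.
  by have [s [[ws wy] []]] := filter_ex (filterI (filterI Fx (xyE.1 Fx)) Fg).
have Fy : \forall s \near F, (w y s : set G) (g s).
  apply: filterS (filterI nFx Fg) => s [/= nws nw].
  by apply: contrapT => nwy; apply: nw.
by have [s [ws]] := filter_ex (filterI (xyE.2 Fy) nFx).
Qed.

(** Sequences over [set (set G)] give the completion at least as many subsets as [set (set G)] has
    elements. A bijection with [G] would pull them back to distinct subsets of [G], against Cantor's
    theorem. *)
Lemma not_small_fin_eq (G : profiniteGroupType) : ~ small G ->
  exists2 H : profiniteGroupType, fin G = fin H & ~ topgroup_isomorphic G H.
Proof.
move=> nG; have [F [UF TF]] := ultraFilterLemma (seq_filter_proper (set (set G))).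
exists (ultra_completion G UF); first exact: fin_ultra_completion.
move=> [f [g [_ _ _ _ gK]]].
have [u uI] := ultra_completion_large UF nG TF.
apply: (@Cantor_powerset (set G) (fun y => f @^-1` u y)) => y z yz.
apply: uI; apply/seteqP; split=> h; rewrite -(gK h) => uh.
  by have : (f @^-1` u y) (g h) by []; rewrite yz.
by have : (f @^-1` u z) (g h) by []; rewrite -yz.
Qed.

Theorem theorem28 (G : profiniteGroupType) :
  small G <->
  (forall H : profiniteGroupType, fin G = fin H -> topgroup_isomorphic G H).
Proof.
split=> [sG H|isoG]; first exact: small_isomorphic.
by apply: contrapT => /not_small_fin_eq[H GH]; apply; exact: isoG.
Qed.
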